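(* Let $(X,T)$ be a minimal system, $d\ge1$ an integer, and $x,y\in X$. The following conditions are equivalent: (1) $(x,y)\in\mathbf{RP}^{[d]}(X)$; (2) $(x,y,y,\dots,y)=(x,y^{[d+1]}_* )\in\mathbf Q^{[d+1]}(X)$; (3) $(x,y,y,\dots,y)=(x,y^{[d+1]}_* )\in\overline{\mathcal F^{[d+1]}}(x^{[d+1]})$.
   Context: A system $(X,T)$ is a compact metric space $X$ (metric $\rho$) with a homeomorphism $T:X\to X$; it is minimal if every orbit $\{T^nx:n\in\mathbb Z\}$ is dense. $\mathbf{RP}^{[d]}(X)$ (regionally proximal relation of order $d$) is the set of $(x,y)\in X\times X$ such that for every $\delta>0$ there are $x',y'\in X$ and $\mathbf n\in\mathbb Z^d$ with $\rho(x,x')<\delta$, $\rho(y,y')<\delta$ and $\rho(T^{\mathbf n\cdot\epsilon}x',T^{\mathbf n\cdot\epsilon}y')<\delta$ for all $\epsilon\in\{0,1\}^d\setminus\{(0,\dots,0)\}$, where $\mathbf n\cdot\epsilon=\sum_i n_i\epsilon_i$. For an integer $k\ge1$ put $X^{[k]}=X^{\{0,1\}^k}$, points $\mathbf x=(x_\epsilon:\epsilon\in\{0,1\}^k)$. $x^{[k]}$ is the point with all coordinates $x$. $(x,y^{[k]}_* )$ is the point of $X^{[k]}$ whose coordinate at $(0,\dots,0)$ is $x$ and whose other $2^k-1$ coordinates are $y$. For $1\le j\le k$, $T_j^{[k]}:X^{[k]}\to X^{[k]}$ is $(T_j^{[k]}\mathbf x)_\epsilon=Tx_\epsilon$ if $\epsilon_j=1$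 and $x_\epsilon$ if $\epsilon_j=0$; $\mathcal F^{[k]}$ is the group generated by $T_1^{[k]},\dots,T_k^{[k]}$, and $\overline{\mathcal F^{[k]}}(\mathbf x)$ is the closure of the $\mathcal F^{[k]}$-orbit of $\mathbf x$. $\mathbf Q^{[k]}(X)$ is the closure in $X^{[k]}$ of $\{(T^{\mathbf n\cdot\epsilon}x)_{\epsilon\in\{0,1\}^k}: x\in X,\mathbf n\in\mathbb Z^k\}$. *)

(* Defs.v *)
From mathcomp Require Import all_boot all_order all_algebra.
From mathcomp Require Import all_classical all_reals.
From mathcomp Require Import topology.
Set Implicit Arguments.
Unset Strict Implicit.
Unset Printing Implicit Defensive.
Import Order.TTheory GRing.Theory Num.Theory.
Local Open Scope classical_set_scope.
Local Open Scope ring_scope.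

Record homeo (X : topologicalType) := Homeo {
  homeo_fun :> X -> X;
  homeo_inv : X -> X;
  homeo_funK : cancel homeo_fun homeo_inv;
  homeo_invK : cancel homeo_inv homeo_fun;
  homeo_continuous : continuous homeo_fun;
  homeo_inv_continuous : continuous homeo_inv }.

Definition iterz (X : topologicalType) (T : homeo X) (n : int) : X -> X :=
  match n with
  | Posz m => iter m T
  | Negz m => iter m.+1 (homeo_inv T)
  end.

Definition minimal (X : topologicalType) (T : homeo X) : Prop :=
  forall x : X, dense (range (fun n : int => iterz T n x)).

Definition vertex (k : nat) : finType := {ffun 'I_k -> bool}.

Definition vertex0 (k : nat) : vertex k := [ffun => false].

Definition dotv (k : nat) (n : 'I_k -> int) (e : vertex k) : int :=
  \sum_(i < k) n i *+ e i.

Definition RP (R : realType) (X : metricType R) (T : homeo X) (d : nat) :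
    set (X * X) :=
  [set p | forall delta : R, 0 < delta ->
    exists (x' y' : X) (n : 'I_d -> int),
      [/\ mdist p.1 x' < delta, mdist p.2 y' < delta &
          forall e : vertex d, e != vertex0 d ->
            mdist (iterz T (dotv n e) x') (iterz T (dotv n e) y') < delta]].

(* {ptws _ -> _} is the library's name for a product of copies of X with the
   product topology. *)
Notation cubeType X k := {ptws vertex k -> X}.

Definition diag_pt (X : topologicalType) (k : nat) (x : X) : cubeType X k :=
  fun _ => x.
Arguments diag_pt {X} k x.

Definition corner_pt (X : topologicalType) (k : nat) (x y : X) :
    cubeType X k :=
  fun e => if e == vertex0 k then x else y.
Arguments corner_pt {X} k x y.

Definition face_map (X : topologicalType) (T : homeo X) (k : nat) (j : 'I_k)
    (z : cubeType X k) : cubeType X k :=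
  fun e => if e j then T (z e) else z e.

(* When S consists of bijections of Y, this is the subgroup of the group of
   all bijections of Y generated by S. *)
Inductive gen_group (Y : Type) (S : set (Y -> Y)) : set (Y -> Y) :=
| gen_group_id : gen_group S id
| gen_group_gen f : S f -> gen_group S f
| gen_group_comp f g :
    gen_group S f -> gen_group S g -> gen_group S (f \o g)
| gen_group_inv f g :
    gen_group S f -> cancel f g -> cancel g f -> gen_group S g.

Definition face_group (X : topologicalType) (T : homeo X) (k : nat) :
    set (cubeType X k -> cubeType X k) :=
  gen_group (range (@face_map X T k)).
Arguments face_group {X} T k.

Definition face_orbit_closure (X : topologicalType) (T : homeo X) (k : nat)
    (z : cubeType X k) : set (cubeType X k) :=
  closure [set g z | g in face_group T k].

Definition Qcube (X : topologicalType) (T : homeo X) (k : nat) :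
    set (cubeType X k) :=
  closure [set z : cubeType X k | exists (x : X) (n : 'I_k -> int),
                     z = fun e => iterz T (dotv n e) x].
Arguments Qcube {X} T k.

(* Main.v *)
Require Import Defs.
From mathcomp Require Import all_boot all_order all_algebra.
From mathcomp Require Import all_classical all_reals.
From mathcomp Require Import topology.
Set Implicit Arguments.
Unset Strict Implicit.
Unset Printing Implicit Defensive.
Import Order.TTheory GRing.Theory Num.Theory.
Local Open Scope classical_set_scope.
Local Open Scope ring_scope.

(* The heart of the matter is that for every [z] in [Q^[k]] with [z_0 = x], the
   point [x^[k]] lies in the [F^[k]]-orbit closure of [z].
   Orbit closures are images of points under the Ellis semigroup [E] of
   [F^[k]], whose elements act coordinatewise. If [u] is a minimal idempotent of
   the Ellis semigroup of [T] with [u x = x], then the element of [E] acting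
   by [u] on all coordinates but [0] is a minimal idempotent fixing [x^[k]],
   so the orbit closure of [x^[k]] is minimal. By a Baire category argument
   there is a point [x0] such that every [z] in [Q^[k]] with [z_0 = x0] lies in
   the orbit closure of [x0^[k]]; the general case is transported to [x0] by a
   limit of powers of [T], one face at a time.
   For [(x, y)] in [RP^[d]], compactness and minimality give a point of
   [Q^[d+1]] whose two opposite [d]-faces agree except at their first
   coordinates, which are [x] and [y]. An element of the Ellis semigroup of
   [F^[d]] that sends the second face to [y^[d]], applied to both faces,
   sends this point to [(x, y, y, ..., y)]. *)

(** * Product topology, closures and closed images *)

Lemma ptws_cvg (I : eqType) (Y : topologicalType) (F : set_system {ptws I -> Y})
    (z : {ptws I -> Y}) :
  Filter F -> (forall i, (fun f : {ptws I -> Y} => f i) @ F --> z i) -> F --> z.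
Proof.
move=> FF Fz; apply/cvg_sup => i; apply/cvg_image.
  by rewrite eqEsubset; split => y // _; exists (fun=> y).
move=> W /= /Fz Wi; exists [set f : {ptws I -> Y} | W (f i)] => //.
rewrite eqEsubset; split => [y [f Wf <-]//|y Wy].
by exists (fun=> y).
Qed.

Lemma ptws_continuous (I : eqType) (S Y : topologicalType)
    (f : S -> {ptws I -> Y}) :
  (forall i, continuous (fun s => f s i)) -> continuous f.
Proof. by move=> cf s; apply: ptws_cvg => i; apply: cf. Qed.

Lemma ptws_eval_continuous (I : eqType) (Y : topologicalType) (i : I) :
  continuous (fun f : {ptws I -> Y} => f i).
Proof. exact: (@proj_continuous I (fun=> Y) i). Qed.

Lemma ptws_compact (I : eqType) (Y : topologicalType) :
  compact [set: Y] -> compact [set: {ptws I -> Y}].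
Proof.
move=> cY.
rewrite (_ : setT = [set f : {ptws I -> Y} | forall i, [set: Y] (f i)]).
  exact: (@tychonoff I (fun=> Y) (fun=> setT)).
by rewrite eqEsubset; split.
Qed.

Lemma ptws_hausdorff (I : eqType) (Y : topologicalType) :
  hausdorff_space Y -> hausdorff_space {ptws I -> Y}.
Proof. by move=> hY; exact: (@hausdorff_product I (fun=> Y) (fun=> hY)). Qed.

Lemma closure_map (S Y : topologicalType) (f : S -> Y) (A : set S) (B : set Y) :
  continuous f -> (forall a, A a -> closure B (f a)) ->
  forall a, closure A a -> closure B (f a).
Proof.
move=> cf AB a Aa U /nbhs_interior /cf /Aa [b [Ab Ub]].
exact: AB Ab _ Ub.
Qed.

Lemma closure_eqfun (S Y : topologicalType) (f g : S -> Y) (A : set S) :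
  hausdorff_space Y -> continuous f -> continuous g ->
  (forall a, A a -> f a = g a) -> forall a, closure A a -> f a = g a.
Proof.
move=> hY cf cg fg a Aa; apply: hY => U W fU gW.
have Uf : nbhs a (f @^-1` U) by exact: cf.
have Wg : nbhs a (g @^-1` W) by exact: cg.
have [b [Ab [Ub Wb]]] := Aa _ (filterI Uf Wg).
by exists (f b); split => //; rewrite fg.
Qed.

Lemma image_closed (S Y : topologicalType) (f : S -> Y) (A : set S) :
  compact [set: S] -> hausdorff_space Y -> continuous f -> closed A ->
  closed (f @` A).
Proof.
move=> cS hY cf clA; apply: compact_closed => //; apply: continuous_compact.
  by apply: continuous_subspaceT.
exact: subclosed_compact clA cS _.
Qed.

(** * Idempotents in compact right topological semigroups *)

Section Ellis.
Variable S : topologicalType.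
Hypothesis compactS : compact [set: S].
Hypothesis hausdorffS : hausdorff_space S.

(** Zorn's lemma for unions of chains is applied to the sets [U] removed from [A]; compactness keeps
    what remains of [A] along a chain nonempty. [P] will be the property of being a subsemigroup or
    a left ideal. *)
Lemma minimal_closed (P : set (set S)) (A : set S) :
  (forall F : set (set S), F `<=` P -> F !=set0 -> P (\bigcap_(B in F) B)) ->
  closed A -> A !=set0 -> P A ->
  exists M, [/\ closed M, M !=set0, P M, M `<=` A &
    forall B, closed B -> B !=set0 -> P B -> B `<=` M -> M `<=` B].
Proof.
move=> Pcap clA A0 PA.
pose Q : set (set S) :=
  [set U | [/\ closed (A `\` U), A `\` U !=set0 & P (A `\` U)]].
have [F FQ Ftot|U [[clU U0 PU] Umax]] := @Zorn_bigcup S Q.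
  have [->|/set0P [U0 FU0]] := eqVneq F set0.
    by rewrite bigcup_set0 /Q /= setD0.
  pose G : set (set S) := [set A `\` U | U in F].
  have EG : A `\` \bigcup_(X in F) X = \bigcap_(B in G) B.
    rewrite eqEsubset; split=> [a [Aa nFa] _ [U FU <-]|a Ga].
      by split => // Ua; apply: nFa; exists U.
    split; first by have [] := Ga _ (ex_intro2 _ _ U0 FU0 erefl).
    by move=> [U FU Ua]; have [] := Ga _ (ex_intro2 _ _ U FU erefl).
  have G0 : G !=set0 by exists (A `\` U0); exists U0.
  have Gcl B : G B -> closed B by move=> [U /FQ[? _ _] <-].
  rewrite /Q /= EG; split.
  - exact: (@closed_bigI _ _ G id).
  - have GF : ProperFilter (filter_from G id).
      apply: filter_from_proper; last by move=> _ [U /FQ[_ ? _] <-].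
      apply: filter_from_filter; first exact: G0.
      move=> _ _ [U FU <-] [W FW <-].
      have [UW|WU] := Ftot _ _ FU FW.
        exists (A `\` W); first by exists W.
        by move=> a [Aa nW]; split; split => // /UW.
      exists (A `\` U); first by exists U.
      by move=> a [Aa nW]; split; split => // /WU.
    have [p [_ clp]] := compactS GF (filterT : filter_from G id setT).
    exists p => B GB; apply: (Gcl _ GB) => C Cp.
    by apply: clp => //; exists B.
  - by apply: Pcap => // _ [U /FQ[_ _ ?] <-].
exists (A `\` U); split => //.
move=> B clB B0 PB BM a [Aa nUa]; have [//|nBa] := pselect (B a); exfalso.
have EB : A `\` (~` B) = B.
  rewrite setDE setCK.
  by rewrite eqEsubset; split=> [b []//|b Bb]; split => //; have [] := BM _ Bb.
apply: (Umax (~` B)); last by rewrite /Q /= EB.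
by split=> [b Ub Bb|/(_ a nBa)//]; have [] := BM _ Bb.
Qed.

Variable op : S -> S -> S.
Hypothesis opA : forall p q r, op p (op q r) = op (op p q) r.
Hypothesis op_continuous : forall q, continuous (op ^~ q).

(** In a minimal closed subsemigroup [M], [M a = M] for [a] in [M], so the closed subsemigroup of
    all [p] in [M] with [p a = a] is nonempty. By minimality it is [M], hence contains [a]. *)
Lemma ellis_idempotent (A : set S) :
  closed A -> A !=set0 -> (forall p q, A p -> A q -> A (op p q)) ->
  exists2 e, A e & op e e = e.
Proof.
move=> clA A0 opAA.
pose P : set (set S) := [set B | forall p q, B p -> B q -> B (op p q)].
have [F FP _|M [clM [a Ma] PM MA Mmin]] := @minimal_closed P A _ clA A0 opAA.
  by move=> p q Fp Fq B FB; apply: (FP B FB); [apply: Fp|apply: Fq].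
have Maa : M `<=` op ^~ a @` M.
  apply: Mmin.
  - exact: image_closed.
  - by exists (op a a); exists a.
  - move=> _ _ [p Mp <-] [q Mq <-].
    exists (op p (op a q)); last by rewrite !opA.
    by apply: (PM) => //; apply: PM.
  - by move=> _ [p Mp <-]; apply: PM.
have [b Mb ba] := Maa a Ma.
pose B := M `&` [set p | op p a = a].
have MB : M `<=` B.
  apply: Mmin.
  - apply: closedI => //.
    rewrite (_ : [set p | _] = op ^~ a @^-1` [set a])//.
    apply: preimage_closed; first by move=> p _; exact: op_continuous.
    by apply: compact_closed => //; exact: compact_set1.
  - by exists b.
  - move=> p q [Mp pa] [Mq qa]; split; first exact: PM.
    by rewrite /= -opA qa.
  - by move=> p [].
by exists a; [exact: MA|exact: (MB a Ma).2].
Qed.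

(* The idempotent lies in a minimal left ideal of [E]; the last clause is the
   only consequence of that minimality which is needed. *)
Lemma ellis_minimal_idempotent (E K : set S) :
  closed E -> E !=set0 -> (forall p q, E p -> E q -> E (op p q)) ->
  closed K -> (forall p q, K p -> K q -> K (op p q)) ->
  (forall p, E p -> exists2 q, E q & K (op q p)) ->
  exists u, [/\ E u, K u, op u u = u &
    forall v, E v -> op v v = v -> op v u = v -> op u v = u].
Proof.
move=> clE E0 opE clK opK EK.
pose P : set (set S) := [set B | forall p q, E p -> B q -> B (op p q)].
have [F FP _|M [clM [m Mm] PM ME Mmin]] := @minimal_closed P E _ clE E0 opE.
  by move=> p q Ep Fq B FB; apply: (FP B FB) => //; apply: Fq.
have [||u [Mu Ku] uu] := @ellis_idempotent (M `&` K) (closedI clM clK).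
- by have [q Eq Kq] := EK _ (ME _ Mm); exists (op q m); split => //; apply: PM.
- move=> p q [Mp Kp] [Mq Kq]; split; last exact: opK.
  by apply: PM => //; apply: ME.
exists u; split => //; first exact: ME.
(* [E v] is a closed left ideal inside the minimal [M], hence equal to it: [u = q v] for some [q],
   and [u v = q v v = u]. *)
move=> v Ev vv vu; have Mv : M v by rewrite -vu; apply: PM.
have [||||q Eq <-] := Mmin (op ^~ v @` E) _ _ _ _ u Mu.
- exact: image_closed.
- by exists (op v v); exists v.
- by move=> p _ Ep [q Eq <-]; exists (op p q); [exact: opE|rewrite opA].
- by move=> _ [p Ep <-]; apply: PM.
by rewrite -opA vv.
Qed.

End Ellis.

(** * Enveloping semigroups and cubes *)

Section Iterates.
Variables (X : topologicalType) (T : homeo X).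

Lemma iterz_succ n x : iterz T (n + 1) x = T (iterz T n x).
Proof.
case: n => [n|[|n]]; first by rewrite addrC -intS.
  by rewrite (_ : Negz 0 + 1 = 0)//= homeo_invK.
by rewrite NegzE [in LHS]intS opprD addrC addNKr -NegzE /= homeo_invK.
Qed.

Lemma iterz_pred n x : iterz T (n - 1) x = homeo_inv T (iterz T n x).
Proof. by rewrite -{2}(subrK 1 n) iterz_succ homeo_funK. Qed.

Lemma iterzD m n x : iterz T (m + n) x = iterz T m (iterz T n x).
Proof.
elim/int_rect: m => [|m IH|m IH]; first by rewrite add0r.
  by rewrite intS -addrA addrC iterz_succ IH addrC iterz_succ.
by rewrite intS opprD -addrA addrC iterz_pred IH addrC iterz_pred.
Qed.

Lemma iterzN n x : iterz T (- n) (iterz T n x) = x.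
Proof. by rewrite -iterzD addNr. Qed.

Lemma iterzC m n x : iterz T m (iterz T n x) = iterz T n (iterz T m x).
Proof. by rewrite -!iterzD addrC. Qed.

Lemma iterz_continuous n : continuous (iterz T n).
Proof.
elim/int_rect: n => [|n IH|n IH]; first by move=> x; exact: cvg_id.
  rewrite (_ : iterz T _ = T \o iterz T n).
    by move=> x; apply: continuous_comp; [exact: IH|exact: homeo_continuous].
  by apply/funext => x; rewrite intS addrC iterz_succ.
rewrite (_ : iterz T _ = homeo_inv T \o iterz T (- n%:Z)).
  by move=> x; apply: continuous_comp; [exact: IH|exact: homeo_inv_continuous].
by apply/funext => x; rewrite intS opprD addrC iterz_pred.
Qed.

End Iterates.

(* Maps of [X^V] acting coordinate by coordinate: [f : coordmaps X V] sends
   [z] to [v |-> f (v, z v)]. No continuity in [X] is required. *)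
Local Notation coordmaps X V := {ptws (V * X)%type -> X}.

Section Enveloping.
Variables (X : topologicalType) (T : homeo X).
Hypothesis compactX : compact [set: X].
Hypothesis hausdorffX : hausdorff_space X.

Definition coordcomp (V : eqType) (p q : coordmaps X V) : coordmaps X V :=
  fun i => p (i.1, q i).

Definition act (V : eqType) (p : coordmaps X V) (z : {ptws V -> X}) :
  {ptws V -> X} := fun v => p (v, z v).

Definition powers (V : eqType) (g : V -> int) : coordmaps X V :=
  fun i => iterz T (g i.1) i.2.

(* The Ellis enveloping semigroup of the group [powers g], [g \in G], of
   homeomorphisms of [X^V]. *)
Definition env (V : eqType) (G : set (V -> int)) : set (coordmaps X V) :=
  closure (@powers V @` G).

(** The induction on faces needs cubes that vary in some directions only, hence the parameter [G];
    [QcubeE] recovers [Qcube]. *)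
Definition cube (V : eqType) (G : set (V -> int)) : set {ptws V -> X} :=
  closure [set z : {ptws V -> X} |
    exists2 g, G g & exists x, z = fun v => iterz T (g v) x].

Lemma coordcompA (V : eqType) (p q r : coordmaps X V) :
  coordcomp p (coordcomp q r) = coordcomp (coordcomp p q) r.
Proof. by []. Qed.

Lemma act_comp (V : eqType) (p q : coordmaps X V) z :
  act (coordcomp p q) z = act p (act q z).
Proof. by []. Qed.

Lemma coordcomp_continuous (V : eqType) (q : coordmaps X V) :
  continuous (fun p => coordcomp p q).
Proof. by apply: ptws_continuous => i; exact: ptws_eval_continuous. Qed.

Lemma act_continuous (V : eqType) (z : {ptws V -> X}) :
  continuous (fun p : coordmaps X V => act p z).
Proof. by apply: ptws_continuous => i; exact: ptws_eval_continuous. Qed.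

Lemma powers_cube (V : eqType) (G : set (V -> int)) g z :
  (forall g h, G g -> G h -> G (fun v => g v + h v)) ->
  G g -> cube G z -> cube G (act (powers g) z).
Proof.
move=> GD Gg; apply: closure_map.
  apply: ptws_continuous => v z'.
  apply: (@continuous_comp _ _ _ (fun z'' : {ptws V -> X} => z'' v)).
    exact: ptws_eval_continuous.
  exact: iterz_continuous.
move=> _ [h Gh [x ->]]; apply: subset_closure.
exists (fun v => g v + h v); first exact: GD.
by exists x; apply/funext => v; rewrite iterzD.
Qed.

Lemma env_cube (V : eqType) (G : set (V -> int)) p z :
  (forall g h, G g -> G h -> G (fun v => g v + h v)) ->
  env G p -> cube G z -> cube G (act p z).
Proof.
move=> GD Gp Gz; move: p Gp; apply: closure_map; first exact: act_continuous.
by move=> _ [g Gg <-]; exact: powers_cube.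
Qed.

(** Composition is continuous in [p] for every [q], but an arbitrary [p] need not be continuous. So
    the closure is taken first in [p], which reduces to powers, and then in [q]. *)
Lemma env_comp (V : eqType) (G : set (V -> int)) p q :
  (forall g h, G g -> G h -> G (fun v => g v + h v)) ->
  env G p -> env G q -> env G (coordcomp p q).
Proof.
move=> GD Gp Gq; move: p Gp; apply: closure_map.
  exact: coordcomp_continuous.
move=> _ [g Gg <-]; move: q Gq; apply: closure_map.
  apply: ptws_continuous => v q.
  apply: (@continuous_comp _ _ _ (fun q' : coordmaps X V => q' v)).
    exact: ptws_eval_continuous.
  exact: iterz_continuous.
move=> _ [h Gh <-]; apply: subset_closure; exists (fun v => g v + h v).
  exact: GD.
by apply/funext => v; rewrite /coordcomp /powers iterzD.
Qed.

(** Each coordinate of [f p] being a coordinate of [p] or a constant makes [f] continuous. This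
    covers spreading one map over a face, projecting to a vertex and reindexing vertices. *)
Lemma env_map (V W : eqType) (G : set (V -> int)) (H : set (W -> int))
    (f : coordmaps X V -> coordmaps X W) :
  (forall i, (exists j, (fun p => f p i) = (fun p => p j)) \/
             (exists x, (fun p => f p i) = (fun=> x))) ->
  (forall g, G g -> exists2 h, H h & f (powers g) = powers h) ->
  forall p, env G p -> env H (f p).
Proof.
move=> fi fG; apply: closure_map.
  apply: ptws_continuous => i; case: (fi i) => [[j]|[x]] ->.
    exact: ptws_eval_continuous.
  exact: cst_continuous.
move=> _ [g Gg <-]; apply: subset_closure.
by have [h Hh ->] := fG g Gg; exists h.
Qed.

Lemma env_closed (V : eqType) (G : set (V -> int)) : closed (env G).
Proof. exact: closed_closure. Qed.

(** Evaluation at [z] is continuous and [env G] is compact, so the image on the right is closed. *)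
Lemma orbit_closureE (V : eqType) (G : set (V -> int)) (z : {ptws V -> X}) :
  closure [set act (powers g) z | g in G] = [set act p z | p in env G].
Proof.
rewrite eqEsubset; split; last first.
  move=> _ [p Gp <-]; move: p Gp; apply: closure_map.
    exact: act_continuous.
  by move=> _ [g Gg <-]; apply: subset_closure; exists g.
rewrite [X in _ `<=` X](_ : _ = closure [set act p z | p in env G]).
  apply: closureS => _ [g Gg <-]; exists (powers g) => //.
  by apply: subset_closure; exists g.
apply/closure_id; apply: image_closed.
- exact: ptws_compact.
- exact: ptws_hausdorff.
- exact: act_continuous.
- exact: env_closed.
Qed.

(** With [unit] as index type the Ellis semigroup of [T] itself is an instance of [env]. *)
Definition env1 : set (coordmaps X unit) := env setT.

(** A diagonal power may have its exponent outside [G]; it preserves cubes all the same, since it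
    commutes with the other powers and merely moves the base point. *)
Lemma env_diag_cube (V : eqType) (G : set (V -> int)) p z :
  env1 p -> cube G z -> cube G (fun v => p (tt, z v)).
Proof.
move=> Ep Gz; move: p Ep.
apply: (@closure_map _ _ (fun p : coordmaps X unit =>
  (fun v => p (tt, z v)) : {ptws V -> X})).
  by apply: ptws_continuous => v; exact: ptws_eval_continuous.
move=> _ [n _ <-]; move: z Gz; apply: closure_map.
  apply: ptws_continuous => v z.
  apply: (@continuous_comp _ _ _ (fun z'' : {ptws V -> X} => z'' v)).
    exact: ptws_eval_continuous.
  exact: iterz_continuous.
move=> _ [h Gh [x ->]]; apply: subset_closure; exists h => //.
by exists (iterz T (n tt) x); apply/funext => v; rewrite /powers/= iterzC.
Qed.

Hypothesis minimalT : minimal T.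

Lemma env1_transitive x y : exists2 p, env1 p & p (tt, x) = y.
Proof.
have /= : closure [set act (powers g) (fun=> x) | g in setT]
    ((fun=> y) : {ptws unit -> X}).
  pose c (a : X) : {ptws unit -> X} := fun=> a.
  apply: (@closure_map _ _ c (range (fun n : int => iterz T n x))).
  - by apply: ptws_continuous => i a; exact: cvg_id.
  - move=> _ [n _ <-]; apply: subset_closure; exists (fun=> n) => //.
  - move=> B /nbhs_interior yB; rewrite setIC.
    have [|z [Bz xz]] := minimalT x _ (@open_interior _ B).
      by exists y; exact: nbhs_singleton yB.
    by exists z; split => //; exact: interior_subset.
rewrite orbit_closureE => -[p Ep pE]; exists p => //.
by have := congr1 (fun f : {ptws unit -> X} => f tt) pE.
Qed.

(** The semigroup [K] is that of the elements fixing [x]; [env1_transitive] gives the return to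
    it. *)
Lemma env1_minimal_idempotent x : exists u, [/\ env1 u, u (tt, x) = x,
  coordcomp u u = u &
  forall v, env1 v -> coordcomp v v = v -> coordcomp v u = v ->
    coordcomp u v = u].
Proof.
have [] := @ellis_minimal_idempotent _ (ptws_compact compactX)
  (ptws_hausdorff hausdorffX) (@coordcomp unit) (@coordcompA unit)
  (@coordcomp_continuous unit) env1 [set p | p (tt, x) = x].
- exact: env_closed.
- by exists (powers (fun=> 0)); apply: subset_closure; exists (fun=> 0).
- by move=> p q; apply: env_comp.
- rewrite (_ : [set p | _] =
    (fun p : coordmaps X unit => p (tt, x)) @^-1` [set x])//.
  apply: preimage_closed; first by move=> p _; exact: ptws_eval_continuous.
  by apply: compact_closed => //; exact: compact_set1.
- by move=> p q /= px qx; rewrite /coordcomp/= qx.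
- move=> p Ep; have [q Eq qx] := env1_transitive (p (tt, x)) x.
  by exists q.
by move=> u [? ? ? ?]; exists u.
Qed.

End Enveloping.

Section MoreEnveloping.
Variables (X : topologicalType) (T : homeo X).
Hypothesis hausdorffX : hausdorff_space X.

Lemma env_coord_id (V : eqType) (G : set (V -> int)) p v a :
  (forall g, G g -> g v = 0) -> env T G p -> p (v, a) = a.
Proof.
move=> Gv; move: p; apply: closure_eqfun => //.
- exact: ptws_eval_continuous.
- exact: cst_continuous.
- by move=> _ [g Gg <-]; rewrite /powers /= Gv.
Qed.

Lemma env_coord (V : eqType) (G : set (V -> int)) p v :
  env T G p -> env1 T (fun i => p (v, i.2)).
Proof.
move: p; apply: (env_map (f := fun p i => p (v, i.2))) => [i|g Gg].
  by left; exists (v, i.2).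
by exists (fun=> g v).
Qed.

Lemma env_sub (V : eqType) (G H : set (V -> int)) :
  G `<=` H -> env T G `<=` env T H.
Proof. by move=> GH; apply: closureS; exact: image_subset. Qed.

Lemma env_powers (V : eqType) (G : set (V -> int)) g :
  G g -> env T G (powers T g).
Proof. by move=> Gg; apply: subset_closure; exists g. Qed.

Lemma cube_reindex (V W : eqType) (G : set (V -> int)) (H : set (W -> int))
    (f : W -> V) z :
  (forall g, G g -> H (fun w => g (f w))) ->
  cube T G z -> cube T H (fun w => z (f w)).
Proof.
move=> GH; move: z; apply: (closure_map (f := fun z : {ptws V -> X} =>
  (fun w => z (f w)) : {ptws W -> X})).
  by apply: ptws_continuous => w; exact: ptws_eval_continuous.
move=> _ [g Gg [x ->]]; apply: subset_closure; exists (fun w => g (f w)).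
  exact: GH.
by exists x.
Qed.

End MoreEnveloping.

(** * Generic points *)

Section Generic.
Variables (R : realType) (X : metricType R) (T : homeo X).
Hypothesis compactX : compact [set: X].

(** Otherwise the sets of points missed by finite families generate a proper filter, and a cluster
    point [p] contradicts the family [[:: p]]. Interiors make nearness to a centre an open
    condition. *)
Lemma totally_bounded (e : R) : 0 < e ->
  exists s : seq X, forall x, exists2 c, c \in s & (ball c e)° x.
Proof.
move=> e0; apply: contrapT => /forallNP ns.
pose F := filter_from [set: seq X]
  (fun s => [set x | forall c, c \in s -> ~ (ball c e)° x]).
have FF : ProperFilter F.
  apply: filter_from_proper.
    apply: filter_from_filter; first by exists [::].
    move=> s t _ _; exists (s ++ t) => // x /= xst.
    by split=> c cs; apply: xst; rewrite mem_cat cs ?orbT.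
  move=> s _; have /existsNP[x /forall2NP xs] := ns s.
  by exists x => c cs; have [/(_ cs)|] := xs c.
have [p [_ clp]] := compactX FF (filterT : F setT).
have [||q [/= + pq]] :=
  clp [set x | forall c, c \in [:: p] -> ~ (ball c e)° x] (ball p e)°.
- by exists [:: p].
- by apply: nbhs_interior; exact: nbhsx_ballx.
- by move=> /(_ p); rewrite mem_head => /(_ isT).
Qed.

Lemma ptws_nbhs_ball (V : finType) (z : {ptws V -> X}) (U : set {ptws V -> X}) :
  nbhs z U <->
  exists2 e : R, 0 < e & forall z', (forall v, ball (z v) e (z' v)) -> U z'.
Proof.
pose B (e : R) := [set z' : {ptws V -> X} | forall v, ball (z v) e (z' v)].
split; last first.
  move=> [e e0 BU]; apply: (@filterS _ _ _ (B e)); first exact: BU.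
  apply: (@filter_forall _ V
    (fun v => [set z' : {ptws V -> X} | ball (z v) e (z' v)]) (nbhs z)) => v.
  apply: (@ptws_eval_continuous _ _ v z); exact: nbhsx_ballx.
pose F := filter_from [set e : R | 0 < e] B.
have FF : Filter F.
  apply: filter_from_filter; first by exists 1; exact: ltr01.
  move=> e d /= e0 d0; exists (Num.min e d); first by rewrite /= lt_min e0.
  move=> z' Bz'; split=> v; apply: le_ball (Bz' v); rewrite ge_min lexx ?orbT//.
have Fz : F --> z.
  apply: ptws_cvg => v W /nbhs_ballP[e /= e0 eW]; exists e => // z' Bz'.
  exact/eW/Bz'.
by move=> /Fz [e e0 BU]; exists e.
Qed.

(** As [x] and [y] may be exchanged, this bounds by [e] the Hausdorff distance, for the sup metric,
    between the [G]-orbits of the diagonal points over [x] and [y]. *)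
Definition oscillation_le (V : finType) (G : set (V -> int)) (e : R)
    (W : set X) :=
  forall x y g, W x -> W y -> G g -> exists2 h, G h &
    forall v, ball (iterz T (g v) x) e (iterz T (h v) y).

(* Cover [X] by finitely many balls and record for each point the set of
   itineraries of its [G]-orbit through this cover: this finite set is lower
   semicontinuous in the point, hence locally constant around a point where
   its cardinality is maximal. *)
Lemma small_oscillation (V : finType) (G : set (V -> int)) (e : R)
    (W : set X) : 0 < e -> open W -> W !=set0 ->
  exists W', [/\ open W', W' !=set0, closure W' `<=` W & oscillation_le G e W'].
Proof.
move=> e0 oW [w Ww]; have e20 : 0 < e / 2 by rewrite divr_gt0.
have [s sX] := totally_bounded e20.
pose near_it (c : {ffun V -> seq_sub s}) (x : X) := exists2 g, G g &
  forall v, (ball (val (c v)) (e / 2))° (iterz T (g v) x).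
pose types x := [set c | `[< near_it c x >]]%SET.
pose P m := `[< exists2 x, W x & #|types x| = m >].
have [||m /asboolP[x Wx mE] mmax] := @ex_maxnP P #|{ffun V -> seq_sub s}|.
- by exists #|types w|; apply/asboolP; exists w.
- by move=> m /asboolP[x _ <-]; exact: max_card.
have Nx : nbhs x [set y | W y /\ types x \subset types y].
  apply: filterI; first exact: open_nbhs_nbhs.
  have : nbhs x [set y | forall c, c \in types x -> c \in types y].
    apply: (@filter_forall _ _
      (fun c => [set y | c \in types x -> c \in types y])) => c.
    have [|_] := boolP (c \in types x); last exact: nearW.
    rewrite inE => /asboolP[g Gg cg].
    have : nbhs x [set y | forall v,
        (ball (val (c v)) (e / 2))° (iterz T (g v) y)].
      apply: (@filter_forall _ _
        (fun v => [set y |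
          (ball (val (c v)) (e / 2))° (iterz T (g v) y)])) => v.
      apply: iterz_continuous.
      exact: nbhs_interior (cg v).
    by apply: filterS => y cy _; rewrite inE; apply/asboolP; exists g.
  by apply: filterS => y xy; apply/fintype.subsetP => c; exact: xy.
(* Regularity shrinks to a neighbourhood whose closure still has both properties, so that
   [closure W'] stays in [W]. *)
have [C xC CN] := uniform_regular Nx.
exists C°; split.
- exact: open_interior.
- by exists x; exact: nbhs_singleton (nbhs_interior xC).
- by move=> y /(closureS (@interior_subset _ C)) /CN [].
(* [types y] contains [types x], whose cardinality is already maximal. *)
have CE y : C° y -> types y = types x.
  move=> /interior_subset /subset_closure /CN [Wy xy].
  apply/esym/eqP; rewrite eqEcard xy mE; apply: mmax.
  by apply/asboolP; exists y.
move=> a b g aC bC Gg.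
(* An itinerary [c] of [a] under [g] is also realized at [b] by some [h]; the two orbit points are
   compared through the centres [c v]. *)
have /choice[c cP] v : exists c : seq_sub s,
    (ball (val c) (e / 2))° (iterz T (g v) a).
  by have [c cs ca] := sX (iterz T (g v) a); exists (SeqSub cs).
have : [ffun v => c v] \in types a.
  by rewrite inE; apply/asboolP; exists g => // v; rewrite ffunE.
rewrite (CE _ aC) -(CE _ bC) inE => /asboolP[h Gh hc]; exists h => // v.
rewrite [e]splitr.
apply: (@ball_triangle _ _ (val (c v))); last first.
  by have /interior_subset := hc v; rewrite ffunE.
by apply: ball_sym; exact: interior_subset (cP v).
Qed.

(** Baire's argument with nested open sets of shrinking oscillation: a cluster point lies in all of
    their closures, hence in all of them. The point [x] starts the construction with a nonempty
    space. *)
Lemma zero_oscillation (V : finType) (G : set (V -> int)) (x : X) :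
  exists x0, forall n, exists2 W,
    open W /\ W x0 & oscillation_le G (n.+1%:R^-1 : R) W.
Proof.
have step (nW : nat * set X) : exists W', open nW.2 -> nW.2 !=set0 ->
    [/\ open W', W' !=set0, closure W' `<=` nW.2 &
      oscillation_le G (nW.1.+1%:R^-1 : R) W'].
  case: nW => n W /=; have [[oW W0]|nW] := pselect (open W /\ W !=set0).
    have [|W' W'P] := @small_oscillation V G n.+1%:R^-1 W _ oW W0.
      by rewrite invr_gt0 ltr0n.
    by exists W'.
  by exists W => oW W0; case: nW.
have [f fP] := choice step.
(* [W 0] is the whole space; the bound [1/(n+1)] is obtained on [W n.+1]. *)
pose fix W n := if n is m.+1 then f (m, W m) else setT.
have WP n : open (W n) /\ W n !=set0.
  elim: n => [|n [oW W0]]; first by split; [exact: openT|exists x].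
  by have [] := fP (n, W n) oW W0.
have WS n : [/\ open (W n.+1), W n.+1 !=set0, closure (W n.+1) `<=` W n &
    oscillation_le G (n.+1%:R^-1 : R) (W n.+1)].
  by have [oW W0] := WP n; exact: fP (n, W n) oW W0.
have Wle m n : (m <= n)%N -> W n `<=` W m.
  move=> /subnK <-; elim: (n - m)%N => [//|k IH] a.
  by have [_ _ cW _] := WS (k + m)%N; move=> /subset_closure/cW/IH.
have FF : ProperFilter (filter_from [set: nat] W).
  apply: filter_from_proper; last by move=> n _; have [] := WP n.
  apply: filter_from_filter; first by exists 0%N.
  move=> m n _ _; exists (maxn m n) => // a Wa.
  by split; apply: Wle Wa; rewrite ?leq_maxl ?leq_maxr.
have [x0 [_ clx0]] := compactX FF (filterT : filter_from _ W setT).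
have Wx0 n : W n x0.
  have [_ _ cW _] := WS n; apply: cW => B Bx0.
  by apply: clx0 => //; exists n.+1.
by exists x0 => n; have [oW _ _ osc] := WS n; exists (W n.+1).
Qed.

(** Let [x0] have zero oscillation. A cube with base point [a] close to [z] has [a] close to
    [z v0 = x0], because its exponent vanishes at [v0]; replacing [a] by [x0] and adjusting the
    exponent costs arbitrarily little. *)
Lemma generic_point (V : finType) (v0 : V) (G : set (V -> int)) (x : X) :
  (forall g, G g -> g v0 = 0) ->
  exists x0, forall z, cube T G z -> z v0 = x0 ->
    exists2 p, env T G p & act p (fun=> x0) = z.
Proof.
move=> G0; have [x0 x0P] := zero_oscillation G x.
exists x0 => z Gz zv0.
suff : closure [set act (powers T g) (fun=> x0) | g in G] z.
  rewrite (orbit_closureE _ compactX (@metric_hausdorff _ X)).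
  by move=> [p Gp pz]; exists p.
move=> U /ptws_nbhs_ball[e e0 eU].
have e20 : 0 < e / 2 by rewrite divr_gt0.
have [n ne] : exists n, n.+1%:R^-1 < e / 2.
  move: (e / 2) e20 => d d0; exists (Num.truncn d^-1).
  by rewrite invf_plt ?posrE// truncnS_gt.
have [W [oW Wx0] osc] := x0P n.
have : nbhs z [set z' : {ptws V -> X} |
    W (z' v0) /\ forall v, ball (z v) (e / 2) (z' v)].
  apply: filterI.
    apply: (@ptws_eval_continuous _ _ v0 z); apply: open_nbhs_nbhs.
    by rewrite zv0.
  by apply/ptws_nbhs_ball; exists (e / 2).
move=> /Gz[_ [[g Gg [a ->]] [/= Wa za]]].
rewrite (G0 _ Gg) /= in Wa.
have [h Gh gh] := osc a x0 g Wa Wx0 Gg.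
exists (act (powers T h) (fun=> x0)); split; first by exists h.
apply: eU => v; rewrite [e]splitr; apply: ball_triangle (za v) _.
by apply: le_ball (gh v); exact: ltW.
Qed.

End Generic.

(** * Face groups *)

Section Faces.
Variables (R : realType) (X : metricType R) (T : homeo X) (k : nat).
Hypothesis compactX : compact [set: X].
Hypothesis minimalT : minimal T.
Implicit Types (J : {set 'I_k}) (e : vertex k).

(* The exponents of the group generated by the face maps with index in [J]. *)
Definition face_exp J : set (vertex k -> int) :=
  range (fun (n : 'I_k -> int) e => \sum_(i in J) n i *+ e i).

Lemma face_exp_add J g h :
  face_exp J g -> face_exp J h -> face_exp J (fun v => g v + h v).
Proof.
move=> [m _ <-] [n _ <-]; exists (fun i => m i + n i) => //.
apply/funext => e; rewrite -big_split; apply: eq_bigr => i _.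
by rewrite mulrnDl.
Qed.

Lemma face_exp_zero J : face_exp J (fun=> 0).
Proof.
exists (fun=> 0) => //; apply/funext => e; rewrite big1// => i _.
by rewrite mul0rn.
Qed.

Lemma face_exp_sub J J' : J' \subset J -> face_exp J' `<=` face_exp J.
Proof.
move=> JJ' _ [n _ <-]; exists (fun i => if i \in J' then n i else 0) => //.
apply/funext => e; rewrite (big_setID J')/= (finset.setIidPr JJ').
rewrite [X in _ + X]big1 ?addr0 => [|i].
  by apply: eq_bigr => i ->.
by rewrite !inE => /andP[/negbTE -> _]; rewrite mul0rn.
Qed.

Definition face_power (j : 'I_k) (p : coordmaps X unit) :
    coordmaps X (vertex k) :=
  fun i => if i.1 j then p (tt, i.2) else i.2.

Lemma env_face J j p :
  j \in J -> env1 T p -> env T (face_exp J) (face_power j p).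
Proof.
move=> jJ; move: p; apply: env_map => [[e a]|g _].
  rewrite /face_power /=; case: (e j); first by left; exists (tt, a).
  by right; exists a.
exists (fun e => g tt *+ e j).
  exists (fun i => if i == j then g tt else 0) => //; apply/funext => e.
  rewrite (bigD1 j)//= eqxx big1 ?addr0// => i /andP[_ /negbTE ->].
  by rewrite mul0rn.
by apply/funext => -[e a]; rewrite /face_power /powers /=; case: (e j).
Qed.

Definition faces_power (s : seq 'I_k) (u : coordmaps X unit) :
    coordmaps X (vertex k) :=
  fun i => if has (fun j => i.1 j) s then u (tt, i.2) else i.2.

(** Composing [face_power j u] over [j] in [s] applies [u] several times at a vertex lying on
    several faces; idempotence reduces this to once. *)
Lemma env_faces J (s : seq 'I_k) u : {subset s <= J} -> env1 T u ->
  coordcomp u u = u -> env T (face_exp J) (faces_power s u).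
Proof.
move=> sJ Eu uu; elim: s sJ => [_|j s IH sJ].
  rewrite (_ : faces_power _ _ = powers T (fun=> 0)).
    by apply: env_powers; exact: face_exp_zero.
  by apply/funext => -[e a].
rewrite (_ : faces_power _ _ = coordcomp (face_power j u) (faces_power s u)).
  apply: env_comp.
  - exact: face_exp_add.
  - by apply: env_face => //; apply: sJ; rewrite mem_head.
  - by apply: IH => i si; apply: sJ; rewrite in_cons si orbT.
have {}uu a : u (tt, u (tt, a)) = u (tt, a).
  exact: (congr1 (fun f => f (tt, a)) uu).
apply/funext => -[e a]; rewrite /coordcomp /face_power /faces_power /=.
by case: (e j) => //=; case: ifP => // _; rewrite uu.
Qed.

Lemma face_exp_vertex J e : (forall j, j \in J -> ~~ e j) ->
  forall g, face_exp J g -> g e = 0.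
Proof.
move=> eJ _ [n _ <-]; rewrite big1// => i /eJ /negbTE ->.
by rewrite mulr0n.
Qed.

(** Let [w] be the idempotent acting by [u] at the vertices moved by [J]. If [v = r p w] is
    idempotent, then [w v = w], and so [w r] brings [p x] back:
    [w r p x = w r p w x = w v x = w x = x], with [x] read diagonally. *)
Lemma face_orbit_minimal J x p : env T (face_exp J) p ->
  exists2 q, env T (face_exp J) q & act (coordcomp q p) (fun=> x) = (fun=> x).
Proof.
move=> Ep; have hX := metric_hausdorff (T := X).
have [u [Eu ux uu umin]] := env1_minimal_idempotent compactX hX minimalT x.
pose w := faces_power (enum J) u.
have Ew : env T (face_exp J) w.
  by apply: env_faces => // j; rewrite mem_enum.
have ww : coordcomp w w = w.
  apply/funext => -[e a]; rewrite /coordcomp /w /faces_power /=.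
  have uua : u (tt, u (tt, a)) = u (tt, a).
    exact: (congr1 (fun f => f (tt, a)) uu).
  by case: (has _ _).
have wx : act w (fun=> x) = (fun=> x).
  by apply/funext => e; rewrite /act /w /faces_power /= ux if_same.
have ED := @face_exp_add J.
(* The elements [r p w] form a closed semigroup, since [(r p w) (r' p w) = (r p w r') p w]. *)
have [|||v [r Er rv] vv] := @ellis_idempotent _ (ptws_compact compactX)
  (ptws_hausdorff hX) (@coordcomp X (vertex k)) (@coordcompA X (vertex k))
  (@coordcomp_continuous X (vertex k))
  [set coordcomp (coordcomp r p) w | r in env T (face_exp J)].
- apply: (@image_closed _ _ (fun r => coordcomp (coordcomp r p) w)).
  + exact: ptws_compact.
  + exact: ptws_hausdorff.
  + move=> r; apply: (@continuous_comp _ _ _ (fun r' => coordcomp r' p)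
      (fun r' => coordcomp r' w)); exact: coordcomp_continuous.
  + exact: env_closed.
- by exists (coordcomp (coordcomp p p) w); exists p.
- move=> _ _ [r Er <-] [r' Er' <-].
  exists (coordcomp (coordcomp (coordcomp r p) w) r') => //.
  by do !apply: env_comp => //.
have Ev : env T (face_exp J) v by rewrite -rv; do !apply: env_comp => //.
(* Vertex by vertex: off the faces in [J] both factors are the identity; elsewhere [v] acts by an
   idempotent absorbing [u] on the right, and minimality of [u] applies. *)
have wv : coordcomp w v = w.
  apply/funext => -[e a]; rewrite /coordcomp /=.
  have [/allP eJ|/allPn[j]] := boolP (all (fun j => ~~ e j) (enum J)).
    rewrite (env_coord_id hX a _ Ev) //; apply: face_exp_vertex => j jJ.
    by apply: eJ; rewrite mem_enum.
  move=> jJ /negPn ej; have hJ : has (fun j => e j) (enum J).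
    by apply/hasP; exists j.
  rewrite /w /faces_power /= hJ.
  apply: (congr1 (fun f => f (tt, a)) (umin (fun i => v (e, i.2)) _ _ _)).
  - exact: env_coord Ev.
  - have vve b : v (e, v (e, b)) = v (e, b).
      exact: (congr1 (fun f => f (e, b)) vv).
    by apply/funext => -[t b]; rewrite /coordcomp /= vve.
  - apply/funext => -[t b]; have := congr1 (fun f => coordcomp f w (e, b)) rv.
    rewrite -[coordcomp (coordcomp (coordcomp r p) w) w]coordcompA ww rv.
    by rewrite /coordcomp /w /faces_power /= hJ; case: t.
exists (coordcomp w r); first exact: env_comp.
transitivity (act (coordcomp w v) (fun=> x)); last by rewrite wv.
by rewrite -rv !act_comp wx.
Qed.

Definition lower (j : 'I_k) e : vertex k := [ffun i => e i && (i != j)].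

Lemma lower_id j e : e j = false -> lower j e = e.
Proof.
move=> ej; apply/ffunP => i; rewrite ffunE.
by case: eqP => [->|]; rewrite ?ej ?andbT.
Qed.

(** The term of index [j] vanishes at [lower j e] and the others are unchanged. *)
Lemma face_exp_lower J j g : j \in J -> face_exp J g ->
  face_exp (J :\ j) (fun e => g (lower j e)).
Proof.
move=> jJ [n _ <-]; exists n => //; apply/funext => e.
rewrite [RHS](big_setD1 j)//= ffunE eqxx andbF add0r; apply: eq_bigr => i.
by rewrite !inE ffunE => /andP[-> _]; rewrite andbT.
Qed.

Lemma face_exp_vertex0 J g : face_exp J g -> g (vertex0 k) = 0.
Proof. by apply: face_exp_vertex => j _; rewrite ffunE. Qed.

(* Induction on [J]: clear the face [e j = 0], then push the opposite face to
   a generic [x0] by a limit [p] of powers of [T_j]. Some [p1] in the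
   enveloping semigroup sends the cube [p z1], which lies over [x0], to the
   diagonal; on the face [e j = 0] it acts as [p2], which does not depend on
   the coordinate [j], so that [p1 pj z1 = p2 pj x]. *)
Lemma cube_to_diag J z : cube T (face_exp J) z ->
  exists2 p, env T (face_exp J) p & act p z = (fun=> z (vertex0 k)).
Proof.
have hX := metric_hausdorff (T := X).
have [m] := ubnP #|J|; elim: m => // m IH in J z *; rewrite ltnS => Jm Jz.
set x := z (vertex0 k).
have [J0|[j jJ]] := set_0Vmem J.
  exists (powers T (fun=> 0)); first by apply: env_powers; exact: face_exp_zero.
  apply/funext => e; rewrite /act /powers /= /x; move: z Jz {x}.
  apply: closure_eqfun => //.
  - exact: ptws_eval_continuous.
  - exact: ptws_eval_continuous.
  - move=> _ [g Jg [a ->]].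
    by rewrite !(@face_exp_vertex J _ _ g)// => i; rewrite J0 inE.
have JjJ : J :\ j \subset J by exact: subD1set.
(* The face [e j = 0], copied onto the opposite one, is a cube for [J :\ j]. Applied to [z] itself,
   [p0] then makes that face constant. *)
have [||p0 Ep0 p0z] := IH (J :\ j) (fun e => z (lower j e)).
- by apply: leq_trans Jm; rewrite (cardsD1 j J) jJ.
- by apply: cube_reindex Jz => g; exact: face_exp_lower.
have l0 : lower j (vertex0 k) = vertex0 k by rewrite lower_id// ffunE.
move/(env_sub (face_exp_sub JjJ)) in Ep0.
pose z1 := act p0 z.
have Jz1 : cube T (face_exp J) z1 by apply: env_cube => //; exact: face_exp_add.
have z1x e : e j = false -> z1 e = x.
  move=> ej; have := congr1 (fun f => f e) p0z.
  by rewrite /act /= l0 lower_id.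
(* Applying [p] diagonally moves [z1] over the generic [x0]; it is then some [q] applied to the
   diagonal of [x0], and minimality of that orbit closure gives the return [p1]. *)
have [x0 x0P] := generic_point T compactX x (@face_exp_vertex0 J).
have [p Ep px] := env1_transitive compactX hX minimalT x x0.
have [|//|q Eq qx0] := x0P (fun e => p (tt, z1 e)).
- exact: env_diag_cube.
- by rewrite z1x// ffunE.
have [p1 Ep1 p1q] := face_orbit_minimal x0 Eq.
have {q Eq qx0 p1q} p1x0 e : p1 (e, p (tt, z1 e)) = x0.
  have := congr1 (fun f => f e) p1q.
  by rewrite act_comp qx0.
pose p2 : coordmaps X (vertex k) := fun i => p1 (lower j i.1, i.2).
have Ep2 : env T (face_exp J) p2.
  move: p1 Ep1 {p1x0} @p2; apply: env_map => [i|g Jg].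
    by left; exists (lower j i.1, i.2).
  exists (fun e => g (lower j e)) => //; apply: face_exp_sub JjJ _ _.
  exact: face_exp_lower.
pose pj : coordmaps X (vertex k) := face_power j p.
have Epj : env T (face_exp J) pj by exact: env_face.
have [q Eq qx] : exists2 q, env T (face_exp J) q &
    act (coordcomp q (coordcomp p2 pj)) (fun=> x) = (fun=> x).
  apply: face_orbit_minimal; apply: env_comp => //.
  exact: face_exp_add.
exists (coordcomp q (coordcomp p1 (coordcomp pj p0))).
  by do !apply: env_comp => //; exact: face_exp_add.
(* The arguments of [q] agree: if [e j] holds, both are [x0], because [z1] is [x] at [lower j e];
   otherwise both are [p1 (e, x)]. *)
rewrite act_comp -[RHS]qx [RHS]act_comp; congr act; apply/funext => e.
rewrite !act_comp -/z1 /act /p2 /pj /face_power /=.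
have le : lower j e j = false by rewrite ffunE eqxx andbF.
case: ifP => ej; last by rewrite z1x// lower_id.
by rewrite p1x0 px -[LHS](p1x0 (lower j e)) z1x// px.
Qed.

End Faces.

(** * The regionally proximal relation *)

Section FaceGroup.
Variables (X : topologicalType) (T : homeo X) (k : nat).
Implicit Types (m n : 'I_k -> int) (e : vertex k).

Let face_act n : cubeType X k -> cubeType X k := act (powers T (dotv n)).

Lemma dotvD m n e : dotv (fun i => m i + n i) e = dotv m e + dotv n e.
Proof. by rewrite /dotv -big_split; apply: eq_bigr => i _; rewrite mulrnDl. Qed.

Lemma dotvN n e : dotv (fun i => - n i) e = - dotv n e.
Proof. by rewrite /dotv -sumrN; apply: eq_bigr => i _; rewrite mulNrn. Qed.

Lemma dotv0 e : dotv (fun=> 0) e = 0 :> int.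
Proof. by rewrite /dotv big1// => i _; rewrite mul0rn. Qed.

Lemma dotv_delta (j : 'I_k) (c : int) e :
  dotv (fun i => if i == j then c else 0) e = c *+ e j.
Proof.
rewrite /dotv (bigD1 j)//= eqxx big1 ?addr0// => i /negbTE ->.
by rewrite mul0rn.
Qed.

Lemma face_actD m n : face_act (fun i => m i + n i) = face_act m \o face_act n.
Proof.
apply/funext => z; apply/funext => e.
by rewrite /face_act /act /powers /= dotvD iterzD.
Qed.

Lemma face_act0 : face_act (fun=> 0) = id.
Proof.
apply/funext => z; apply/funext => e.
by rewrite /face_act /act /powers /= dotv0.
Qed.

Lemma face_actNK n : cancel (face_act n) (face_act (fun i => - n i)).
Proof.
by move=> z; apply/funext => e; rewrite /face_act /act /powers /= dotvN iterzN.
Qed.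

Lemma face_actKN n : cancel (face_act (fun i => - n i)) (face_act n).
Proof.
move=> z; apply/funext => e; rewrite /face_act /act /powers /= dotvN.
by rewrite -{1}[dotv n e]opprK iterzN.
Qed.

Lemma face_act_delta j :
  face_act (fun i => if i == j then 1 else 0) = @face_map X T k j.
Proof.
apply/funext => z; apply/funext => e.
by rewrite /face_act /act /powers /face_map /= dotv_delta; case: (e j).
Qed.

(** Composition and inversion of generators act on exponents by addition and negation. Conversely an
    exponent vector is assembled from multiples of unit vectors, by induction on the integer and
    then on the list of indices. *)
Lemma face_groupE : face_group T k = range face_act.
Proof.
rewrite eqEsubset; split => [f|_ [n _ <-]].
  elim=> {f} [|_ [j _ <-]|_ _ _ [m _ <-] _ [n _ <-]|_ f _ [n _ <-] fK Kf].
  - by exists (fun=> 0); rewrite ?face_act0.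
  - by exists (fun i => if i == j then 1 else 0); rewrite ?face_act_delta.
  - by exists (fun i => m i + n i); rewrite ?face_actD.
  - exists (fun i => - n i) => //; apply/funext => z.
    by rewrite -{2}[z](face_actKN n) fK.
have GN m : face_group T k (face_act m) ->
    face_group T k (face_act (fun i => - m i)).
  move=> Gm; apply: (gen_group_inv Gm); first exact: face_actNK.
  exact: face_actKN.
have G1 j : face_group T k (face_act (fun i => if i == j then 1 else 0)).
  by rewrite face_act_delta; apply: gen_group_gen; exists j.
have GD m m' : face_group T k (face_act m) -> face_group T k (face_act m') ->
    face_group T k (face_act (fun i => m i + m' i)).
  by move=> Gm Gm'; rewrite face_actD; exact: gen_group_comp.
have Gj j c : face_group T k (face_act (fun i => if i == j then c else 0)).
  elim/int_rect: c => [|c IH|c IH].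
  - rewrite (_ : (fun i => _) = fun=> 0).
      by rewrite face_act0; exact: gen_group_id.
    by apply/funext => i; rewrite if_same.
  - have := GD _ _ (G1 j) IH; congr (face_group T k (face_act _)).
    by apply/funext => i; case: eqP => _; rewrite ?intS ?addr0.
  - have := GD _ _ (GN _ (G1 j)) IH; congr (face_group T k (face_act _)).
    by apply/funext => i; case: eqP => _; rewrite ?intS ?opprD ?subr0.
have Gs s : uniq s ->
    face_group T k (face_act (fun i => if i \in s then n i else 0)).
  elim: s => [_|j s IH /= /andP[js /IH Gs]].
    rewrite (_ : (fun i => _) = fun=> 0) ?face_act0//.
    exact: gen_group_id.
  have := GD _ _ (Gj j (n j)) Gs; congr (face_group T k (face_act _)).
  apply/funext => i; rewrite in_cons; case: eqP => [->|_] /=.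
    by rewrite (negbTE js) addr0.
  by rewrite add0r.
have := Gs _ (enum_uniq 'I_k); congr (face_group T k (face_act _)).
by apply/funext => i; rewrite mem_enum.
Qed.

Lemma face_expT : @face_exp k [set: 'I_k]%SET = range (@dotv k).
Proof.
rewrite (_ : @dotv k = fun n e => \sum_(i in [set: 'I_k]%SET) n i *+ e i)//.
apply/funext => n; apply/funext => e.
by rewrite /dotv; apply: eq_bigl => i; rewrite inE.
Qed.

Lemma face_orbit_closureE (z : cubeType X k) : compact [set: X] ->
  hausdorff_space X ->
  face_orbit_closure T z =
    [set act p z | p in env T (face_exp [set: 'I_k]%SET)].
Proof.
move=> cX hX; rewrite -orbit_closureE// face_expT /face_orbit_closure.
rewrite face_groupE; congr closure; rewrite eqEsubset; split.
  by move=> _ [_ [n _ <-] <-]; exists (dotv n) => //; exists n.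
by move=> _ [_ [n _ <-] <-]; exists (face_act n) => //; exists n.
Qed.

Lemma QcubeE : Qcube T k = cube T (face_exp [set: 'I_k]%SET).
Proof.
rewrite face_expT /Qcube /cube; congr closure; rewrite eqEsubset; split.
  by move=> _ [x [n ->]]; exists (dotv n); [exists n|exists x].
by move=> _ [_ [n _ <-] [x ->]]; exists x, n.
Qed.

End FaceGroup.

(** * Regional proximality and corner points of cubes *)

Section RP.
Variables (R : realType) (X : metricType R) (T : homeo X) (d : nat).
Hypothesis compactX : compact [set: X].
Hypothesis minimalT : minimal T.
Implicit Types (E : vertex d.+1) (e : vertex d).

(** The index [ord0] is the extra direction: it separates the two [d]-faces, over which the points
    [x'] and [y'] of the definition of [RP] will sit. *)
Definition vcons (b : bool) e : vertex d.+1 :=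
  [ffun i => if unlift ord0 i is Some i' then e i' else b].

Definition vtail E : vertex d := [ffun i => E (lift ord0 i)].

Lemma dotvE n E :
  dotv n E = n ord0 *+ E ord0 + dotv (fun i => n (lift ord0 i)) (vtail E).
Proof.
rewrite /dotv big_ord_recl; congr (_ + _); apply: eq_bigr => i _.
by rewrite ffunE.
Qed.

Lemma vcons0 b e : vcons b e ord0 = b.
Proof. by rewrite ffunE unlift_none. Qed.

Lemma vtailK b e : vtail (vcons b e) = e.
Proof. by apply/ffunP => i; rewrite !ffunE liftK. Qed.

Lemma vcons_tail E : vcons (E ord0) (vtail E) = E.
Proof.
by apply/ffunP => i; rewrite ffunE; case: unliftP => [j|] ->; rewrite ?ffunE.
Qed.

Lemma vcons_vertex0 : vcons false (vertex0 d) = vertex0 d.+1.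
Proof.
by apply/ffunP => i; rewrite !ffunE; case: unliftP => [j|] _; rewrite ?ffunE.
Qed.

(** Near the corner point take a cube with base point [a] and exponents [n]; use [a] and its
    translate by [n ord0] as [x'] and [y']. For [e] nonzero, the vertices over [e] in both faces
    carry points close to [y]. *)
Lemma Qcube_RP x y : Qcube T d.+1 (corner_pt d.+1 x y) -> RP T d (x, y).
Proof.
move=> Qxy delta delta0.
have delta20 : 0 < delta / 2 by rewrite divr_gt0.
have : nbhs (corner_pt d.+1 x y) [set z | forall E,
    ball (corner_pt d.+1 x y E) (delta / 2) (z E)].
  by apply/ptws_nbhs_ball; exists (delta / 2).
move=> /Qxy[_ [[a [n ->]] /= naP]].
exists a, (iterz T (n ord0) a), (fun i => n (lift ord0 i)).
have ltd u v : ball u (delta / 2) v -> mdist u v < delta.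
  rewrite ballEmdist /= => /lt_trans; apply.
  by rewrite ltr_pdivrMr// ltr_pMr// ltr1n.
have corner b e : vcons b e != vertex0 d.+1 ->
    corner_pt d.+1 x y (vcons b e) = y.
  by rewrite /corner_pt => /negbTE ->.
have dot b e : dotv n (vcons b e) =
    n ord0 *+ b + dotv (fun i => n (lift ord0 i)) e.
  by rewrite dotvE vcons0 vtailK.
have true0 e : vcons true e != vertex0 d.+1.
  apply/eqP => /(congr1 (fun f : vertex d.+1 => f ord0)).
  by rewrite vcons0 ffunE.
split=> [||e e0] /=.
- apply: ltd; have := naP (vertex0 d.+1).
  by rewrite /corner_pt eqxx -vcons_vertex0 dot add0r (_ : dotv _ _ = 0)//;
    rewrite /dotv big1// => i _; rewrite ffunE.
- apply: ltd; have := naP (vcons true (vertex0 d)).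
  rewrite corner ?true0// dot (_ : dotv _ (vertex0 d) = 0) ?addr0//.
  by rewrite /dotv big1// => i _; rewrite ffunE.
- have := naP (vcons true e); have := naP (vcons false e).
  rewrite !corner ?true0//; last first.
    apply: contra e0 => /eqP fe; rewrite -[e](vtailK false) fe.
    by apply/eqP/ffunP => i; rewrite !ffunE.
  rewrite !dot mulr0n add0r mulr1n addrC iterzD => /ball_sym fe te.
  by have := ball_triangle fe te; rewrite -splitr ballEmdist.
Qed.

Lemma ball_eq (a b : X) : (forall e : R, 0 < e -> ball a e b) -> a = b.
Proof.
move=> ab; apply: (@metric_hausdorff _ X) => U W /nbhs_ballP[e /= e0 eU] bW.
by exists b; split; [apply: eU; exact: ab|exact: nbhs_singleton].
Qed.

Definition upper E : vertex d.+1 := vcons true (vtail E).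

Lemma upper_id E : E ord0 -> upper E = E.
Proof. by move=> E0; rewrite -[RHS]vcons_tail E0. Qed.

Lemma dotv_upper n E : E ord0 = false -> dotv n (upper E) = n ord0 + dotv n E.
Proof. by move=> E0; rewrite !dotvE vcons0 vtailK E0 mulr0n add0r. Qed.

Lemma vtail_eq0 E : E ord0 = false -> vtail E = vertex0 d -> E = vertex0 d.+1.
Proof. by move=> E0 tE; rewrite -[E]vcons_tail E0 tE vcons_vertex0. Qed.

(** Minimality replaces [y'] by a translate of [x'], so that both faces belong to one cube
    satisfying the conclusions approximately; compactness gives an exact one. *)
Lemma RP_cube x y : RP T d (x, y) -> exists z, [/\ Qcube T d.+1 z,
  z (vertex0 d.+1) = x, z (upper (vertex0 d.+1)) = y &
  forall E, E != vertex0 d.+1 -> z E = z (upper E)].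
Proof.
move=> RPxy; set v0 := vertex0 d.+1.
pose A (r : R) := [set z | [/\ Qcube T d.+1 z, ball x r (z v0),
  ball y r (z (upper v0)) & forall E, E != v0 -> ball (z E) r (z (upper E))]].
have A0 r : 0 < r -> A r !=set0.
  move=> r0; have r20 : 0 < r / 2 by rewrite divr_gt0.
  have [x' [y' [n [/= xx' yy' nP]]]] := RPxy _ r20.
  (* The translate must stay close to [y'] after each of the finitely many powers [dotv n e]. *)
  pose O := [set w | ball y' (r / 2) w /\ forall e,
    ball (iterz T (dotv n e) y') (r / 2) (iterz T (dotv n e) w)].
  have Oy' : nbhs y' O°.
    apply: nbhs_interior.
    apply: filterI; first exact: nbhsx_ballx.
    apply: (@filter_forall _ _ (fun e => [set w |
      ball (iterz T (dotv n e) y') (r / 2) (iterz T (dotv n e) w)])) => e.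
    by apply: (@iterz_continuous _ T (dotv n e) y'); exact: nbhsx_ballx.
  have [|w [/interior_subset[y'm ym] [m _ mx']]] :=
    minimalT x' _ (@open_interior _ O).
    by exists y'; exact: nbhs_singleton Oy'.
  rewrite -mx' in y'm ym.
  pose n' i := if unlift ord0 i is Some i' then n i' else m.
  have n'0 : n' ord0 = m by rewrite /n' unlift_none.
  have n'E E : dotv n' E = m *+ E ord0 + dotv n (vtail E).
    rewrite dotvE n'0; congr (_ + dotv _ _).
    by apply/funext => i; rewrite /n' liftK.
  have n'v0 : dotv n' v0 = 0.
    by rewrite /dotv big1// => i _; rewrite ffunE.
  exists (fun E => iterz T (dotv n' E) x'); split.
  - by apply: subset_closure; exists x', n'.
  - rewrite n'v0 ballEmdist /=; apply: lt_trans xx' _.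
    by rewrite ltr_pdivrMr// ltr_pMr// ltr1n.
  - rewrite dotv_upper ?ffunE// n'v0 n'0 addr0 [r]splitr.
    by apply: ball_triangle y'm; rewrite ballEmdist.
  - move=> E Ev0; have [E0|/negbTE E0] := boolP (E ord0).
      by rewrite upper_id//; exact: ballxx.
    have tE : vtail E != vertex0 d.
      by apply: contra Ev0 => /eqP /(vtail_eq0 E0) ->.
    rewrite dotv_upper// n'0 addrC iterzD n'E E0 mulr0n add0r [r]splitr.
    by apply: ball_triangle (ym _); rewrite ballEmdist; exact: nP.
(* The sets [A r] decrease with [r]; a cluster point as [r] tends to 0 is the desired cube. *)
have FF : ProperFilter (filter_from [set r : R | 0 < r] A).
  apply: filter_from_proper; last exact: A0.
  apply: filter_from_filter; first by exists 1; exact: ltr01.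
  move=> r s /= r0 s0; exists (Num.min r s); first by rewrite /= lt_min r0.
  have le_r : Num.min r s <= r by rewrite ge_min lexx.
  have le_s : Num.min r s <= s by rewrite ge_min lexx orbT.
  move=> z [Qz zx zy zE]; split; split => //; by
    [exact: le_ball zx|exact: le_ball zy|move=> E /zE; exact: le_ball].
have [z [_ clz]] := ptws_compact compactX FF (filterT : filter_from _ A setT).
have zA r : 0 < r -> exists2 z', A r z' & forall E, ball (z E) r (z' E).
  move=> r0; have [||z' [Az' zz']] :=
    clz (A r) [set z' | forall E, ball (z E) r (z' E)].
  - by exists r.
  - by apply/ptws_nbhs_ball; exists r.
  - by exists z'.
exists z; split.
- have clQ : closed (Qcube T d.+1) by exact: closed_closure.
  apply: clQ => B zB.
  have [||z' [[Qz' _ _ _] Bz']] := clz (A 1) B => //.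
    by exists 1 => //=; exact: ltr01.
  by exists z'.
- apply/esym/ball_eq => r r0; have r20 : 0 < r / 2 by rewrite divr_gt0.
  have [z' [_ zx _ _] zz'] := zA _ r20.
  by rewrite [r]splitr; apply: ball_triangle zx _; exact: ball_sym.
- apply/esym/ball_eq => r r0; have r20 : 0 < r / 2 by rewrite divr_gt0.
  have [z' [_ _ zy _] zz'] := zA _ r20.
  by rewrite [r]splitr; apply: ball_triangle zy _; exact: ball_sym.
- move=> E Ev0; apply: ball_eq => r r0.
  have r40 : 0 < r / 2 / 2 by rewrite !divr_gt0.
  have [z' [_ _ _ zE] zz'] := zA _ r40.
  rewrite [r]splitr; apply: (@ball_triangle _ _ (z' (upper E))).
    rewrite [r / 2]splitr; apply: ball_triangle (zz' E) _; exact: zE.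
  apply: ball_sym; apply: le_ball (zz' (upper E)).
  by rewrite ler_pdivrMr// ler_pMr ?divr_gt0// ler1n.
Qed.

(** The cube [z] agrees with its upper face copied onto both faces, except possibly at vertex 0. An
    element [p] sending that copy to the diagonal of [y] fixes coordinate 0, so it sends [z] to the
    corner point. *)
Lemma RP_Qcube x y : RP T d (x, y) -> Qcube T d.+1 (corner_pt d.+1 x y).
Proof.
move=> /RP_cube[z [Qz zx zy zE]].
have hX := metric_hausdorff (T := X).
pose J := [set~ ord0 : 'I_d.+1]%SET.
have [|p Ep pz] := @cube_to_diag _ X T d.+1 compactX minimalT J
    (fun E => z (upper E)).
  move: z Qz {zx zy zE}; apply: (closure_map (f := fun z : cubeType X d.+1 =>
    (fun E => z (upper E)) : cubeType X d.+1)).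
    by apply: ptws_continuous => E; exact: ptws_eval_continuous.
  move=> _ [a [n ->]]; apply: subset_closure.
  exists (fun E => \sum_(i in J) n i *+ E i); first by exists n.
  (* On the upper face the exponent [n ord0] is constant and is absorbed into the base point. *)
  exists (iterz T (n ord0) a); apply/funext => E; rewrite -iterzD; congr iterz.
  rewrite dotvE vcons0 vtailK mulr1n addrC; congr (_ + _).
  rewrite /dotv [RHS](eq_bigl (fun i => i != ord0)).
    2: by move=> i; rewrite !inE.
  rewrite [RHS]big_mkcond [RHS]big_ord_recl /= add0r.
  by apply: eq_bigr => i _; rewrite ffunE.
have pE E : p (E, z (upper E)) = y.
  by have := congr1 (fun f => f E) pz; rewrite /act zy.
rewrite QcubeE in Qz *.
rewrite (_ : corner_pt _ _ _ = act p z).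
  apply: env_cube => //; first exact: face_exp_add.
  by apply: env_sub Ep; apply: face_exp_sub; exact: finset.subsetT.
apply/funext => E; rewrite /act /corner_pt; case: ifP => [/eqP ->|/negbT Ev0].
  rewrite zx; apply/esym; apply: env_coord_id Ep => //.
  exact: face_exp_vertex0.
by rewrite zE// pE.
Qed.

(** If [p] sends [(x, y, ..., y)] to the diagonal of [x], it sends the diagonal of [y] to
    [(y, x, ..., x)]. An element [q] returning this to the diagonal of [y] sends [x] to [y] at every
    nonzero vertex and fixes coordinate 0, so it takes the diagonal of [x] to the corner point. *)
Lemma Qcube_face_orbit x y : Qcube T d.+1 (corner_pt d.+1 x y) <->
  face_orbit_closure T (diag_pt d.+1 x) (corner_pt d.+1 x y).
Proof.
have hX := metric_hausdorff (T := X).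
rewrite face_orbit_closureE// QcubeE; split; last first.
  move=> [p Ep <-]; apply: env_cube => //; first exact: face_exp_add.
  apply: subset_closure; exists (fun=> 0); first exact: face_exp_zero.
  by exists x.
move=> /(cube_to_diag compactX minimalT)[p Ep pxy].
have [q Eq qy] := face_orbit_minimal compactX minimalT y Ep.
exists q => //; apply/funext => E; rewrite /act /corner_pt.
case: ifP => [/eqP ->|/negbT Ev0].
  by apply: env_coord_id Eq => //; exact: face_exp_vertex0.
have <- : p (E, y) = x.
  have := congr1 (fun f => f E) pxy.
  by rewrite /act /corner_pt eqxx (negbTE Ev0).
exact: (congr1 (fun f => f E) qy).
Qed.

End RP.

Theorem theorem3p2 (R : realType) (X : metricType R) (T : homeo X) (d : nat)
    (x y : X) (hX : compact [set: X]) (hT : minimal T) (hd : (1 <= d)%N) :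
  (RP T d (x, y) <-> Qcube T d.+1 (corner_pt d.+1 x y)) /\
  (Qcube T d.+1 (corner_pt d.+1 x y) <->
   face_orbit_closure T (diag_pt d.+1 x) (corner_pt d.+1 x y)).
Proof.
split; last exact: Qcube_face_orbit.
by split; [exact: RP_Qcube|exact: Qcube_RP].
Qed.
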